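(* For every finite $S\subset\mathbb{N}$ with $\#S\ge 2$ let $P_S^*=\{p_S(\pi,\cdot):\pi\in\mathcal{P}_S^*\}$ be a family of probability distributions on $\mathcal{P}_S$ indexed by $\mathcal{P}_S^*:=\mathcal{P}_S\setminus\{\mathbf{1}_S\}$, with $p_S(\pi,\mathbf{1}_S)<1$ for all $\pi\in\mathcal{P}_S^*$. For every finite $A\subset\mathbb{N}$ let $Q_A(\cdot,\cdot)$ be the ancestral branching Markov kernel on $\mathcal{T}_A$ defined by the family $\{P_S^*:S\subseteq A\}$, that is, $$Q_A(T,T')=\prod_{b\in T':\#b\ge 2}\frac{p_b(\Pi_{T_{|b}},\Pi_{T'_{|b}})}{1-p_b(\Pi_{T_{|b}},\mathbf{1}_b)},\qquad T,T'\in\mathcal{T}_A.$$ Assume further that for all finite $A,B\subset\mathbb{N}$ with $\#A=\#B$ and every injection $\psi:A\to B$ with induced map $\psi^*:\mathcal{P}_A\to\mathcal{P}_B$, one has $p_A(\pi,\mathbf{1}_A)=p_B(\psi^*(\pi),\mathbf{1}_B)$ for all $\pi\in\mathcal{P}_A^*$. Then the family $\{Q_A: A\subset\mathbb{N}\text{ finite}\}$ is finitely exchangeable if and only if the collection $\{P_S^*:S\subset\mathbb{N}\text{ finite}\}$ is finitely exchangeable.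
   Context: $\mathcal{P}_A$ is the set of partitions of $A\subset\mathbb{N}$ into non-empty blocks; $\mathbf{1}_A=\{A\}$ is the one-block partition; $\#$ denotes cardinality. A fragmentation tree of $A$ is a collection $T$ of non-empty subsets of $A$ with $A\in T$ (the root), containing all singletons of $A$, and such that any two elements of $T$ are either disjoint or one contains the other. $\mathcal{T}_A$ is the set of fragmentation trees of $A$. For $t\in T$, $t\neq A$, the parent of $t$ is the smallest element of $T$ strictly containing $t$; for $A$ finite with $\#A\ge 2$, the root partition $\Pi_T$ is the partition of $A$ formed by the elements of $T$ whose parent is $A$ (it always has at least two blocks). For $S\subset A$, $T_{|S}:=\{t\cap S:t\in T\}\setminus\{\emptyset\}\in\mathcal{T}_S$. An injection (bijection) $\psi:A\to B$ with $\#A=\#B$ induces maps $\psi^*:\mathcal{P}_A\to\mathcal{P}_B$ and $\psi^*:\mathcal{T}_A\to\mathcal{T}_B$ by applying $\psi$ to every element of each block, respectively each vertex. The family $\{Q_A\}$ is finitely exchangeable if $Q_A(t,t')=Q_B(\psi^*(t),\psi^*(t'))$ for all finite $A,B$ with $\#A=\#B$, all $t,t'\in\mathcal{T}_A$ and all injections $\psi:A\to B$. The collection $\{P_S^*\}$ is finitely exchangeable if $p_A(\pi,\pi')=p_B(\psi^*(\pi),\psi^*(\pi'))$ for all finite $A,B$ with $\#A=\#B$, all $\pi\in\mathcal{P}_A^*$, $\pi'\in\mathcal{P}_A$ and all injections $\psi:A\to B$. *)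

(* Defs.v *)
From mathcomp Require Import all_boot all_order all_algebra.
From mathcomp Require Export finmap.
From mathcomp Require Import reals.

Set Implicit Arguments.
Unset Strict Implicit.
Unset Printing Implicit Defensive.


Local Open Scope fset_scope.

Definition is_partition (A : {fset nat}) (pi : {fset {fset nat}}) : bool :=
  [&& fset0 \notin pi, fcover pi == A & trivIfset pi].

Definition partitions (A : {fset nat}) : {fset {fset {fset nat}}} :=
  [fset pi in fpowerset (fpowerset A) | is_partition A pi].

Definition one_block (A : {fset nat}) : {fset {fset nat}} := [fset A].

Definition nontrivial_partitions (A : {fset nat}) : {fset {fset {fset nat}}} :=
  partitions A `\ one_block A.

Definition is_frag_tree (A : {fset nat}) (T : {fset {fset nat}}) : bool :=
  [&& fset0 \notin T,
      A \in T,
      [fset [fset a] | a in A] `<=` T &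
      [forall s : T, forall t : T,
         [|| [disjoint val s & val t]%fset, val s `<=` val t | val t `<=` val s]]].

Definition frag_trees (A : {fset nat}) : {fset {fset {fset nat}}} :=
  [fset T in fpowerset (fpowerset A) | is_frag_tree A T].

(* [is_parent T s t]: s is the smallest element of T strictly containing t. *)
Definition is_parent (T : {fset {fset nat}}) (s t : {fset nat}) : bool :=
  [&& s \in T, t `<` s & [forall u : T, (t `<` val u) ==> (s `<=` val u)]].

Definition root_partition (A : {fset nat}) (T : {fset {fset nat}}) :
  {fset {fset nat}} := [fset t in T | is_parent T A t].

Definition restrict_tree (T : {fset {fset nat}}) (S : {fset nat}) :
  {fset {fset nat}} := [fset t `&` S | t in T] `\ fset0.

(* The induced map psi^*, the same formula for partitions and for trees. *)
Definition induced (psi : nat -> nat) (C : {fset {fset nat}}) :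
  {fset {fset nat}} := [fset psi @` (b : {fset nat}) | b in C].

(* An injection A -> B is given by a total function on nat, of which only the
   values on A matter. *)
Definition injection (A B : {fset nat}) (psi : nat -> nat) : Prop :=
  {in A, forall a, psi a \in B} /\ {in A &, injective psi}.

(* p S pi pi' stands for p_S(pi, pi'); its values are meaningful only for
   2 <= #|S|, pi a nontrivial partition of S and pi' a partition of S. *)
Definition partition_family (R : realType) : Type :=
  {fset nat} -> {fset {fset nat}} -> {fset {fset nat}} -> R.

Definition is_distribution (R : realType) (S : {fset nat})
    (mu : {fset {fset nat}} -> R) : Prop :=
  {in partitions S, forall pi, (0 <= mu pi)%R} /\
  (\sum_(pi <- partitions S) mu pi = 1)%R.

(* Q A T T' stands for Q_A(T, T'), for T and T' in frag_trees A. *)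
Definition tree_family (R : realType) : Type :=
  {fset nat} -> {fset {fset nat}} -> {fset {fset nat}} -> R.

(* The product does not mention A, which only determines the state space
   frag_trees A on which the kernel is considered. *)
Definition ancestral_branching_kernel (R : realType) (p : partition_family R) :
    tree_family R :=
  fun A T T' =>
  (\prod_(b <- T' | (2 <= #|` b|)%N)
     (p b (root_partition b (restrict_tree T b))
          (root_partition b (restrict_tree T' b)) /
      (1 - p b (root_partition b (restrict_tree T b)) (one_block b))))%R.

Definition tree_family_exchangeable (R : realType) (Q : tree_family R) : Prop :=
  forall (A B : {fset nat}) (psi : nat -> nat) (t t' : {fset {fset nat}}),
    #|` A| = #|` B| -> injection A B psi ->
    t \in frag_trees A -> t' \in frag_trees A ->
    Q A t t' = Q B (induced psi t) (induced psi t').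

Definition partition_family_exchangeable (R : realType)
    (p : partition_family R) : Prop :=
  forall (A B : {fset nat}) (psi : nat -> nat) (pi pi' : {fset {fset nat}}),
    (2 <= #|` A|)%N -> #|` A| = #|` B| -> injection A B psi ->
    pi \in nontrivial_partitions A -> pi' \in partitions A ->
    p A pi pi' = p B (induced psi pi) (induced psi pi').

(* Main.v *)
(** If [p] is exchangeable then [psi] matches the factors of [Q_A(T, T')] and
of [Q_B(psi T, psi T')] one by one, since root partitions commute with
[psi^*].  Conversely, argue by induction on the size of [A].  The value at
[pi' = 1_A] is part of the hypotheses.  For other [pi'], take trees [T], [T']
with root partitions [pi], [pi'].  In [Q_A(T, T') = Q_B(psi T, psi T')] all
factors except the one at the root agree by induction, so the root factors
agree as soon as the other ones do not vanish.  This is arranged by building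
[T'] top down: each [p_b(rho, .)] gives mass less than 1 to the one-block
partition, hence charges some nontrivial partition of [b]. *)

Require Import Defs.
From mathcomp Require Import all_boot all_order all_algebra finmap reals.
From mathcomp Require Import boolp.

Set Implicit Arguments.
Unset Strict Implicit.
Unset Printing Implicit Defensive.

Import Order.TTheory GRing.Theory Num.Theory.

Local Open Scope fset_scope.
Local Open Scope ring_scope.

(** * Pointwise descriptions of partitions and trees, and restriction of trees *)

Lemma fdisjointPn (K : choiceType) (A B : {fset K}) :
  reflect (exists2 a, a \in A & a \in B) (~~ [disjoint A & B]%fset).
Proof.
apply: (iffP (fset0Pn _)) => [[a]|[a aA aB]].
  by rewrite inE => /andP[]; exists a.
by exists a; rewrite inE aA.
Qed.

Lemma partitionsP (A : {fset nat}) (pi : {fset {fset nat}}) :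
  reflect [/\ fset0 \notin pi, forall b, b \in pi -> b `<=` A,
              forall a, a \in A -> exists2 b, b \in pi & a \in b &
              forall b c a, b \in pi -> c \in pi -> a \in b -> a \in c -> b = c]
          (pi \in partitions A).
Proof.
rewrite /partitions !inE /= fpowersetE.
apply: (iffP andP) => [[piA /and3P[pi0 /eqP covA /trivIfsetP triv]]|].
  split=> // [b bpi|a|b c a bpi cpi ab ac].
  - by rewrite -fpowersetE; apply: (fsubsetP piA).
  - by rewrite -covA => /bigfcupP[b /andP[bpi _] ab]; exists b.
  - apply/eqP; apply: contraT => /(triv _ _ bpi cpi)/fdisjointP/(_ _ ab).
    by rewrite ac.
move=> [pi0 sub cov triv]; split.
  by apply/fsubsetP => b /sub; rewrite fpowersetE.
apply/and3P; split=> //.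
  apply/eqP/fsetP => a; apply/bigfcupP/idP => [[b /andP[/sub/fsubsetP bA _]]|].
    exact: bA.
  by move=> /cov[b bpi ab]; exists b; rewrite ?bpi.
apply/trivIfsetP => b c bpi cpi; apply: contraNT => /fdisjointPn[a ab ac].
by rewrite (triv b c a).
Qed.

Lemma frag_treesP (A : {fset nat}) (T : {fset {fset nat}}) :
  reflect [/\ fset0 \notin T, A \in T,
              forall t, t \in T -> t `<=` A,
              forall a, a \in A -> [fset a] \in T &
              forall s t a, s \in T -> t \in T -> a \in s -> a \in t ->
                (s `<=` t) || (t `<=` s)]
          (T \in frag_trees A).
Proof.
rewrite /frag_trees !inE /= fpowersetE.
apply: (iffP andP) => [[TA /and4P[T0 AT /fsubsetP sing /forallP lam]]|].
  split=> // [t tT|a aA|s t a sT tT a_s a_t].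
  - by rewrite -fpowersetE; apply: (fsubsetP TA).
  - by apply: sing; apply/imfsetP; exists a.
  - have /forallP/(_ [` tT])/= := lam [` sT].
    by case: fdisjointP => // /(_ _ a_s); rewrite a_t.
move=> [T0 AT sub sing lam]; split.
  by apply/fsubsetP => t /sub; rewrite fpowersetE.
apply/and4P; split=> //.
  by apply/fsubsetP => _ /imfsetP[a /= aA ->]; apply: sing.
apply/forallP => s; apply/forallP => t /=.
have [//|/fdisjointPn[a a_s a_t] /=] := boolP [disjoint _ & _]%fset.
exact: lam (valP s) (valP t) a_s a_t.
Qed.

Lemma root_partitionP (A : {fset nat}) (T : {fset {fset nat}}) (t : {fset nat}) :
  reflect [/\ t \in T, A \in T, t `<` A &
              forall u, u \in T -> t `<` u -> A `<=` u]
          (t \in root_partition A T).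
Proof.
rewrite /root_partition !inE /=.
apply: (iffP andP) => [[tT /and3P[AT tA /forallP up]]|[tT AT tA up]].
  by split=> // u uT tu; have := up [` uT]; rewrite /= tu.
by split=> //; apply/and3P; split=> //; apply/forallP => u; apply/implyP/up/valP.
Qed.

(** If [A] itself were a block, every other block, being non-empty and inside [A], would meet it and
    so equal it, leaving only the one-block partition. *)
Lemma nontrivial_partitions_proper (A : {fset nat}) (pi : {fset {fset nat}})
    (b : {fset nat}) :
  pi \in nontrivial_partitions A -> b \in pi -> b `<` A.
Proof.
rewrite in_fsetD1 => /andP[nt /partitionsP[pi0 sub _ triv]] bpi.
rewrite fproperEneq sub // andbT; apply: contraNneq nt => eqbA; subst b.
apply/eqP/fsetP => c; rewrite inE; apply/idP/eqP => [cpi|-> //].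
have /fset0Pn[a ac] : c != fset0 by apply: contraNneq pi0 => <-.
by apply: (triv c A a) => //; apply: (fsubsetP (sub c cpi)).
Qed.

Lemma restrict_treeP (T : {fset {fset nat}}) (S t : {fset nat}) :
  reflect (t != fset0 /\ exists2 u, u \in T & t = u `&` S)
          (t \in restrict_tree T S).
Proof.
rewrite /restrict_tree in_fsetD1.
apply: (iffP andP) => -[t0]; first by case/imfsetP => u uT def_t; split=> //; exists u.
by move=> [u uT def_t]; split=> //; apply/imfsetP; exists u.
Qed.

Lemma restrict_frag_tree (A S : {fset nat}) (T : {fset {fset nat}}) :
  T \in frag_trees A -> S `<=` A -> S != fset0 ->
  restrict_tree T S \in frag_trees S.
Proof.
move=> /frag_treesP[T0 AT sub sing lam] SA S0.
apply/frag_treesP; split.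
- by apply/restrict_treeP => -[/eqP].
- by apply/restrict_treeP; split=> //; exists A => //; apply/esym/fsetIidPr.
- by move=> _ /restrict_treeP[_ [u _ ->]]; apply: fsubsetIr.
- move=> a aS; apply/restrict_treeP; split.
    by apply/fset0Pn; exists a; rewrite inE.
  exists [fset a]; first exact/sing/(fsubsetP SA).
  by apply/esym/fsetIidPl; rewrite fsub1set.
- move=> _ _ a /restrict_treeP[_ [s sT ->]] /restrict_treeP[_ [t tT ->]].
  rewrite !inE => /andP[a_s _] /andP[a_t _].
  by case/orP: (lam s t a sT tT a_s a_t) => /fsetSI-> //; rewrite orbT.
Qed.

Lemma restrict_tree_id (A : {fset nat}) (T : {fset {fset nat}}) :
  T \in frag_trees A -> restrict_tree T A = T.
Proof.
move=> /frag_treesP[T0 _ sub _ _]; apply/fsetP => t.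
apply/restrict_treeP/idP => [[_ [u uT ->]]|tT].
  by rewrite (fsetIidPl (sub u uT)).
split; first by apply: contraNneq T0 => <-.
by exists t => //; apply/esym/fsetIidPl/sub.
Qed.

(** * Root partitions of trees and of their restrictions *)

Lemma root_partition_nontrivial (A : {fset nat}) (T : {fset {fset nat}}) :
  T \in frag_trees A -> (2 <= #|` A|)%N ->
  root_partition A T \in nontrivial_partitions A.
Proof.
move=> /frag_treesP[T0 AT sub sing lam] A2.
rewrite in_fsetD1; apply/andP; split.
  apply/eqP => /fsetP/(_ A); rewrite [in RHS]inE eqxx => /root_partitionP[_ _].
  by rewrite (negPf (fproper_irrefl _)).
apply/partitionsP; split.
- by apply/root_partitionP => -[]; rewrite (negPf T0).
- by move=> b /root_partitionP[_ _ /fproper_sub].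
- move=> a aA.
  pose P n := [exists t : T, [&& val t `<` A, a \in val t & #|` val t| == n]].
  (* The singleton of [a] is a proper vertex because [A] has at least two points; a proper vertex
     through [a] of maximal size will be the block of [a]. *)
  have aP : P 1%N.
    apply/existsP; exists [` sing a aA] => /=.
    by rewrite fproperEcard fsub1set aA cardfs1 A2 inE eqxx.
  have Pbound n : P n -> (n <= #|` A|)%N.
    by move=> /existsP[t /and3P[/fproper_ltn_card/ltnW tA _ /eqP <-]].
  case: (ex_maxnP (ex_intro (fun n => P n) _ aP) Pbound) => n.
  move=> /existsP[[t tT] /= /and3P[tA a_t /eqP <-]] tmax.
  exists t => //; apply/root_partitionP; split=> // u uT tu.
  have au : a \in u by apply: (fsubsetP (fproper_sub tu)).
  apply: contraTT (fproper_ltn_card tu) => nAu; rewrite -leqNgt tmax //.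
  by apply/existsP; exists [` uT]; rewrite /= fproperE sub // nAu au eqxx.
- move=> b c a /root_partitionP[bT _ bA bup] /root_partitionP[cT _ cA cup] ab ac.
  (* Two root blocks that meet are nested, and a strict inclusion would force the larger one to
     contain [A]. *)
  have neq s t : s `<` A -> t `<` A -> s \in T -> t \in T ->
      (forall u, u \in T -> s `<` u -> A `<=` u) -> s `<=` t -> s = t.
    move=> sA tA sT tT sup /eqVfproper[//|/(sup t tT)].
    by move: tA; rewrite fproperE => /andP[_ /negPf->].
  by case/orP: (lam b c a bT cT ab ac) => /neq; [|move=> H; apply/esym; move: H]; apply.
Qed.

(** This is $\Pi_{T_{|b}}$ in the kernel formula: the factor at [b] depends on the trees only
    through it. *)
Definition block_partition (T : {fset {fset nat}}) (b : {fset nat}) :=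
  root_partition b (restrict_tree T b).

Lemma block_partition_nontrivial (A b : {fset nat}) (T : {fset {fset nat}}) :
  T \in frag_trees A -> b `<=` A -> (2 <= #|` b|)%N ->
  block_partition T b \in nontrivial_partitions b.
Proof.
move=> TA bA b2; apply: root_partition_nontrivial => //.
by apply: restrict_frag_tree TA bA _; rewrite -cardfs_gt0 ltnW.
Qed.

(** * Grafting trees on the blocks of a partition below a common root *)

Definition graft (A : {fset nat}) (pi : {fset {fset nat}})
    (F : {fset nat} -> {fset {fset nat}}) : {fset {fset nat}} :=
  A |` \bigcup_(c <- pi) F c.

Section Graft.
Variables (A : {fset nat}) (pi : {fset {fset nat}}).
Variable F : {fset nat} -> {fset {fset nat}}.
Hypothesis pi_nt : pi \in nontrivial_partitions A.
Hypothesis F_tree : forall c, c \in pi -> F c \in frag_trees c.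

Let pi_partition : pi \in partitions A.
Proof. by move: pi_nt; rewrite in_fsetD1 => /andP[]. Qed.

Lemma graftP (t : {fset nat}) :
  reflect (t = A \/ exists2 c, c \in pi & t \in F c) (t \in graft A pi F).
Proof.
apply: (iffP (fset1UP _ _ _)) => -[->|]; try by left.
  by move=> /bigfcupP[c /andP[cpi _] tF]; right; exists c.
by move=> [c cpi tF]; right; apply/bigfcupP; exists c; rewrite ?cpi.
Qed.

(** Two vertices below the root that share a point come from the same [F c], since blocks of [pi]
    are disjoint; there they are nested. *)
Lemma graft_frag_tree : A != fset0 -> graft A pi F \in frag_trees A.
Proof.
move=> A0; have /partitionsP[pi0 pisub cov triv] := pi_partition.
have sub t : t \in graft A pi F -> t `<=` A.
  move=> /graftP[-> //|[c cpi tF]]; apply: fsubset_trans (pisub c cpi).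
  by have /frag_treesP[_ _ + _ _] := F_tree cpi; apply.
apply/frag_treesP; split=> //.
- apply/graftP => -[/esym/eqP|[c /F_tree/frag_treesP[/negP ? _ _ _ _] //]].
  exact/negP.
- by apply/graftP; left.
- move=> a /cov[c cpi ac]; apply/graftP; right; exists c => //.
  by have /frag_treesP[_ _ _ + _] := F_tree cpi; apply.
- move=> s t a sT tT a_s a_t.
  move: (sT) (tT) => /graftP[-> _|[c cpi sF]]; first by rewrite (sub t) ?orbT.
  move=> /graftP[->|[d dpi tF]]; first by rewrite (sub s).
  have /frag_treesP[_ _ csub _ lam] := F_tree cpi.
  have /frag_treesP[_ _ dsub _ _] := F_tree dpi.
  have eqcd : c = d.
    by apply: (triv c d a) => //; [move/csub: sF|move/dsub: tF] => /fsubsetP->.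
  by apply: (lam s t a) => //; rewrite eqcd.
Qed.

(** A vertex of [F c] other than [c] has [c] strictly between it and [A], where [c] is proper in [A]
    because [pi] is nontrivial. Conversely, disjointness of blocks leaves no vertex strictly between
    a block and [A]. *)
Lemma block_partition_graft_root : A != fset0 ->
  block_partition (graft A pi F) A = pi.
Proof.
move=> A0; have /partitionsP[pi0 pisub cov triv] := pi_partition.
rewrite /block_partition restrict_tree_id ?graft_frag_tree //.
apply/fsetP => t; apply/root_partitionP/idP => [[tT _ tA up]|tpi].
  move/graftP: tT => [eqtA|[c cpi tF]].
    by rewrite eqtA (negPf (fproper_irrefl _)) in tA.
  have /frag_treesP[_ cF csub _ _] := F_tree cpi.
  have [->//|tc] := eqVfproper (csub t tF).
  have cT : c \in graft A pi F by apply/graftP; right; exists c.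
  have := nontrivial_partitions_proper pi_nt cpi.
  by rewrite fproperE up ?andbF.
have /frag_treesP[_ tF _ _ _] := F_tree tpi.
split; first by apply/graftP; right; exists t.
- by apply/graftP; left.
- exact: nontrivial_partitions_proper pi_nt tpi.
- move=> u /graftP[-> //|[c cpi uF]] tu.
  have /frag_treesP[_ _ csub _ _] := F_tree cpi.
  have /fset0Pn[a a_t] : t != fset0 by apply: contraNneq pi0 => <-.
  have tc := fproper_sub_trans tu (csub u uF).
  have eqtc : t = c by apply: (triv t c a) => //; apply: (fsubsetP (fproper_sub tc)).
  by rewrite eqtc (negPf (fproper_irrefl _)) in tc.
Qed.

(** Intersecting with [b] empties the vertices lying in other blocks, and the new root [A] leaves
    the same trace [b] as the vertex [c]. *)
Lemma block_partition_graft (b c : {fset nat}) : c \in pi -> b \in F c ->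
  block_partition (graft A pi F) b = block_partition (F c) b.
Proof.
move=> cpi bF; have /partitionsP[pi0 pisub cov triv] := pi_partition.
have /frag_treesP[_ cF csub _ _] := F_tree cpi.
rewrite /block_partition; congr root_partition; apply/fsetP => t.
apply/restrict_treeP/restrict_treeP => -[t0 [u uT def_t]]; split=> //; last first.
  by exists u => //; apply/graftP; right; exists c.
case/graftP: uT => [eq_u|[d dpi uF]].
  exists c => //; rewrite def_t eq_u (fsetIidPr (csub b bF)).
  by apply/fsetIidPr; apply: fsubset_trans (pisub c cpi); apply: csub.
have /fset0Pn[a] := t0; rewrite def_t inE => /andP[au ab].
have /frag_treesP[_ _ dsub _ _] := F_tree dpi.
suff eqdc : d = c by exists u; rewrite // -eqdc.
by apply: (triv d c a) => //; [move/dsub: uF|move/csub: bF] => /fsubsetP->.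
Qed.

End Graft.

(** Top-down construction: choose a partition of [A] satisfying [X], build trees on its blocks
    recursively, and graft them. The predicate [X] may impose a different requirement at each
    vertex. *)
Lemma frag_tree_of_block_partitions
    (X : {fset nat} -> {fset {fset nat}} -> Prop) (A : {fset nat}) :
  A != fset0 ->
  (forall c, c `<=` A -> (2 <= #|` c|)%N ->
     exists2 pi, pi \in nontrivial_partitions c & X c pi) ->
  exists2 T, T \in frag_trees A &
    forall c, c \in T -> (2 <= #|` c|)%N -> X c (block_partition T c).
Proof.
have [n] := ubnP #|` A|; elim: n A => // n IHn A ltAn A0 exX.
have [A1|A2] := leqP #|` A| 1.
  have /cardfs1P[a def_A] : #|` A| == 1%N by rewrite eqn_leq A1 cardfs_gt0.
  (* A singleton carries only the one-vertex tree, and no vertex of it is constrained by [X]. *)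
  exists [fset A]; last by move=> c; rewrite inE => /eqP->; rewrite ltnNge A1.
  apply/frag_treesP; split.
  - by rewrite inE eq_sym.
  - by rewrite inE.
  - by move=> t; rewrite inE => /eqP->.
  - by move=> x; rewrite def_A !inE => /eqP->.
  - by move=> s t x; rewrite !inE => /eqP-> /eqP->; rewrite fsubset_refl.
have [pi pi_nt Xpi] := exX A (fsubset_refl A) A2.
(* Choice needs a value at every [c], so the requirement is conditional on [c \in pi], with the
   default [fset0] elsewhere. *)
have /boolp.choice[F FP] : forall c, exists T, c \in pi -> T \in frag_trees c /\
    forall b, b \in T -> (2 <= #|` b|)%N -> X b (block_partition T b).
  move=> c.
  have [cpi|//] := boolP (c \in pi); last by exists fset0.
  have cA := nontrivial_partitions_proper pi_nt cpi.
  have [||d dc d2|T] := IHn c.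
  - by rewrite (leq_trans (fproper_ltn_card cA)) // -ltnS.
  - move: pi_nt; rewrite in_fsetD1 => /andP[_ /partitionsP[pi0 _ _ _]].
    by apply: contraNneq pi0 => <-.
  - by apply: exX => //; apply: fsubset_trans dc (fproper_sub cA).
  by exists T.
have F_tree c : c \in pi -> F c \in frag_trees c by move=> /FP[].
exists (graft A pi F); first exact: graft_frag_tree.
move=> b /graftP[-> _|[c cpi bF] b2]; first by rewrite block_partition_graft_root.
by rewrite (block_partition_graft pi_nt F_tree cpi bF); apply: (FP c cpi).2.
Qed.

(** * Transport of trees and root partitions along a map injective on [A] *)

Section Induced.
Variables (A : {fset nat}) (psi : nat -> nat).
Hypothesis psi_inj : {in A &, injective psi}.

Lemma mem_imfset_in (a : nat) (s : {fset nat}) :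
  a \in A -> s `<=` A -> (psi a \in psi @` s) = (a \in s).
Proof.
move=> aA sA; apply/imfsetP/idP => [[b /= bs /psi_inj->]|]; last by exists a.
  by [].
  by [].
exact: (fsubsetP sA).
Qed.

Lemma imfset_subset_in (s t : {fset nat}) :
  s `<=` A -> t `<=` A -> (psi @` s `<=` psi @` t) = (s `<=` t).
Proof.
move=> sA tA; apply/idP/idP => [/fsubsetP st|st]; last exact/subset_imfset/fsubsetP.
apply/fsubsetP => a a_s; have aA := fsubsetP sA a a_s.
by rewrite -mem_imfset_in // st // mem_imfset_in.
Qed.

Lemma imfset_inj_in (s t : {fset nat}) :
  s `<=` A -> t `<=` A -> psi @` s = psi @` t -> s = t.
Proof.
move=> sA tA eq_st; apply/eqP; rewrite eqEfsubset; apply/andP.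
by split; rewrite -imfset_subset_in // eq_st.
Qed.

Lemma imfset_proper_in (s t : {fset nat}) :
  s `<=` A -> t `<=` A -> (psi @` s `<` psi @` t) = (s `<` t).
Proof. by move=> sA tA; rewrite !fproperE !imfset_subset_in. Qed.

Lemma mem_induced (C : {fset {fset nat}}) (t : {fset nat}) :
  (forall c, c \in C -> c `<=` A) -> t `<=` A ->
  (psi @` t \in induced psi C) = (t \in C).
Proof.
move=> CA tA; apply/imfsetP/idP => [[u uC /imfset_inj_in->]|] //; first exact: CA.
by exists t.
Qed.

(** Injectivity on [A] makes images commute with intersections of subsets of [A], and images of
    non-empty sets are non-empty. *)
Lemma induced_restrict_tree (T : {fset {fset nat}}) (b : {fset nat}) :
  (forall t, t \in T -> t `<=` A) -> b `<=` A ->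
  restrict_tree (induced psi T) (psi @` b) = induced psi (restrict_tree T b).
Proof.
move=> TA bA.
have imI t : t \in T -> psi @` t `&` psi @` b = psi @` (t `&` b).
  move=> tT; rewrite imfsetI // => x y xt yb; apply: psi_inj.
    exact: (fsubsetP (TA t tT)).
  exact: (fsubsetP bA).
apply/fsetP => s; apply/restrict_treeP/imfsetP => [[s0 [_ /imfsetP[t tT ->] def_s]]|].
  exists (t `&` b); last by rewrite def_s imI.
  apply/restrict_treeP; split; last by exists t.
  by apply: contraNneq s0 => tb0; rewrite def_s imI // tb0 imfset0.
move=> [u /restrict_treeP[/fset0Pn[a au] [t tT def_u]] ->]; split; last first.
  by exists (psi @` t); rewrite ?def_u ?imI //; apply/imfsetP; exists t.
by apply/fset0Pn; exists (psi a); apply/imfsetP; exists a.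
Qed.

(** Parenthood is expressed by membership and inclusions alone, which [psi] preserves and reflects
    on subsets of [A]. *)
Lemma induced_root_partition (T : {fset {fset nat}}) (b : {fset nat}) :
  (forall t, t \in T -> t `<=` A) -> b `<=` A ->
  root_partition (psi @` b) (induced psi T) = induced psi (root_partition b T).
Proof.
move=> TA bA; apply/fsetP => s; apply/root_partitionP/imfsetP.
  move=> [/imfsetP[t tT ->]]; rewrite mem_induced // => bT.
  rewrite imfset_proper_in ?TA // => tb up; exists t => //.
  apply/root_partitionP; split=> // u uT tu.
  by rewrite -imfset_subset_in ?TA // up ?mem_induced ?imfset_proper_in ?TA.
move=> [t /root_partitionP[tT bT tb up] ->].
rewrite !mem_induced ?imfset_proper_in ?TA //; split=> // _ /imfsetP[u uT ->].
by rewrite imfset_subset_in ?imfset_proper_in ?TA //; apply: up.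
Qed.

Lemma induced_block_partition (T : {fset {fset nat}}) (b : {fset nat}) :
  (forall t, t \in T -> t `<=` A) -> b `<=` A ->
  block_partition (induced psi T) (psi @` b) = induced psi (block_partition T b).
Proof.
move=> TA bA; rewrite /block_partition induced_restrict_tree //.
rewrite induced_root_partition // => _ /restrict_treeP[_ [t tT ->]].
by apply: fsubset_trans (TA t tT); apply: fsubsetIl.
Qed.

End Induced.

(** * The kernel as a product of branching factors *)

Definition exchangeable_at (R : realType) (p : partition_family R)
    (A : {fset nat}) : Prop :=
  forall (B : {fset nat}) (psi : nat -> nat) (pi pi' : {fset {fset nat}}),
    #|` A| = #|` B| -> injection A B psi ->
    pi \in nontrivial_partitions A -> pi' \in partitions A ->
    p A pi pi' = p B (induced psi pi) (induced psi pi').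

Definition branching_factor (R : realType) (p : partition_family R)
    (T T' : {fset {fset nat}}) (b : {fset nat}) : R :=
  p b (block_partition T b) (block_partition T' b) /
  (1 - p b (block_partition T b) (one_block b)).

Lemma injection_imfset (A b : {fset nat}) (psi : nat -> nat) :
  {in A &, injective psi} -> b `<=` A ->
  #|` b| = #|` psi @` b| /\ injection b (psi @` b) psi.
Proof.
move=> inj /fsubsetP bA; split; last split.
- by rewrite card_in_imfset // => x y xb yb; apply: inj; apply: bA.
- by move=> a ab; apply/imfsetP; exists a.
- by move=> x y xb yb; apply: inj; apply: bA.
Qed.

Lemma injection_surj (A B : {fset nat}) (psi : nat -> nat) :
  #|` A| = #|` B| -> injection A B psi -> psi @` A = B.
Proof.
move=> cardAB [psiB inj]; apply/eqP; rewrite eqEfcard; apply/andP; split.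
  by apply/fsubsetP => _ /imfsetP[a aA ->]; apply: psiB.
by rewrite card_in_imfset // cardAB.
Qed.

Lemma induced_one_block (A : {fset nat}) (psi : nat -> nat) :
  induced psi (one_block A) = one_block (psi @` A).
Proof. exact: imfset_fset1. Qed.

(** The map sending [b] to its image is injective on the vertices of [T'] and preserves cardinality,
    so the product can be reindexed by [T']. *)
Lemma kernel_induced (R : realType) (p : partition_family R) (A B : {fset nat})
    (psi : nat -> nat) (T T' : {fset {fset nat}}) :
  {in A &, injective psi} -> T' \in frag_trees A ->
  ancestral_branching_kernel p B (induced psi T) (induced psi T') =
  \prod_(b <- T' | (2 <= #|` b|)%N)
    branching_factor p (induced psi T) (induced psi T') (psi @` b).
Proof.
move=> inj /frag_treesP[_ _ sub _ _].
rewrite /ancestral_branching_kernel big_mkcond big_imfset /=; last first.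
  by move=> b c /sub bA /sub cA; apply: (imfset_inj_in inj).
rewrite [in RHS]big_mkcond big_seq [in RHS]big_seq; apply: eq_bigr => b /sub bA.
by have [<-] := injection_imfset inj bA.
Qed.

(** Supplies a default root partition at vertices where none is prescribed. *)
Lemma singletons_nontrivial (A : {fset nat}) : (2 <= #|` A|)%N ->
  [fset [fset a] | a in A] \in nontrivial_partitions A.
Proof.
move=> A2; rewrite in_fsetD1; apply/andP; split.
  apply/eqP => /fsetP/(_ A); rewrite [in RHS]inE eqxx => /imfsetP[a _ eqA].
  by move: A2; rewrite eqA cardfs1.
apply/partitionsP; split.
- by apply/imfsetP => -[a _ /esym/eqP]; rewrite -cardfs_eq0 cardfs1.
- by move=> _ /imfsetP[a aA ->]; rewrite fsub1set.
- by move=> a aA; exists [fset a]; rewrite ?inE //; apply/imfsetP; exists a.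
- by move=> _ _ a /imfsetP[b _ ->] /imfsetP[c _ ->]; rewrite !inE => /eqP<- /eqP<-.
Qed.

(** * The two implications between exchangeability of the kernels and of the partition laws *)

Section Exchangeability.
Variables (R : realType) (p : partition_family R).
Hypothesis p_distr : forall (S : {fset nat}) (pi : {fset {fset nat}}),
  (2 <= #|` S|)%N -> pi \in nontrivial_partitions S ->
  is_distribution S (p S pi).
Hypothesis p_one_block_lt1 : forall (S : {fset nat}) (pi : {fset {fset nat}}),
  (2 <= #|` S|)%N -> pi \in nontrivial_partitions S ->
  p S pi (one_block S) < 1.
Hypothesis p_one_block_exch :
  forall (A B : {fset nat}) (psi : nat -> nat) (pi : {fset {fset nat}}),
    (2 <= #|` A|)%N -> #|` A| = #|` B| -> injection A B psi ->
    pi \in nontrivial_partitions A ->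
    p A pi (one_block A) = p B (induced psi pi) (one_block B).

(** The numerators agree by exchangeability at the single set [b], the denominators by the
    assumption on one-block probabilities. *)
Lemma branching_factor_induced (A b : {fset nat}) (psi : nat -> nat)
    (T T' : {fset {fset nat}}) :
  {in A &, injective psi} -> T \in frag_trees A -> T' \in frag_trees A ->
  b `<=` A -> (2 <= #|` b|)%N -> exchangeable_at p b ->
  branching_factor p (induced psi T) (induced psi T') (psi @` b) =
  branching_factor p T T' b.
Proof.
move=> inj TA T'A bA b2 exch.
have [cardb injb] := injection_imfset inj bA.
have T_nt := block_partition_nontrivial TA bA b2.
have T'_nt := block_partition_nontrivial T'A bA b2.
have /frag_treesP[_ _ subT _ _] := TA; have /frag_treesP[_ _ subT' _ _] := T'A.
rewrite /branching_factor !(induced_block_partition inj) //.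
rewrite -(p_one_block_exch b2 cardb injb T_nt) -(exch _ _ _ _ cardb injb) //.
by move: T'_nt; rewrite in_fsetD1 => /andP[].
Qed.

Lemma one_sub_one_block_neq0 (S : {fset nat}) (pi : {fset {fset nat}}) :
  (2 <= #|` S|)%N -> pi \in nontrivial_partitions S ->
  1 - p S pi (one_block S) != 0.
Proof. by move=> S2 pi_nt; rewrite subr_eq0 gt_eqF // p_one_block_lt1. Qed.

Lemma one_block_partition (A : {fset nat}) :
  A != fset0 -> one_block A \in partitions A.
Proof.
move=> A0; apply/partitionsP; split.
- by rewrite inE eq_sym.
- by move=> b; rewrite inE => /eqP->.
- by move=> a aA; exists A; rewrite ?inE.
- by move=> b c a; rewrite !inE => /eqP-> /eqP->.
Qed.

(** Otherwise the total mass 1 would sit on the one-block partition, whose probability is less than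
    1. *)
Lemma exists_nontrivial_neq0 (S : {fset nat}) (pi : {fset {fset nat}}) :
  (2 <= #|` S|)%N -> pi \in nontrivial_partitions S ->
  exists2 pi', pi' \in nontrivial_partitions S & p S pi pi' != 0.
Proof.
move=> S2 pi_nt; have [_ sum1] := p_distr S2 pi_nt.
have [/hasP[pi' pi'_nt neq0]|none] :=
  boolP (has (fun pi' => p S pi pi' != 0) (nontrivial_partitions S)).
  by exists pi'.
have := p_one_block_lt1 S2 pi_nt; rewrite -[X in _ < X]sum1.
rewrite (big_fsetD1 (one_block S)) /=; last first.
  by rewrite one_block_partition // -cardfs_gt0 ltnW.
rewrite big_seq big1 ?addr0 ?ltxx // => pi' pi'_nt.
by apply/eqP; move/hasPn: none => /(_ pi' pi'_nt); rewrite negbK.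
Qed.

Lemma kernel_exchangeable : partition_family_exchangeable p ->
  tree_family_exchangeable (ancestral_branching_kernel p).
Proof.
move=> exch A B psi T T' _ [_ inj] TA T'A.
rewrite (kernel_induced _ _ _ inj) // [LHS]big_seq_cond [RHS]big_seq_cond.
apply: eq_bigr => b /andP[bT' b2].
have bA : b `<=` A by have /frag_treesP[_ _ + _ _] := T'A; apply.
rewrite (branching_factor_induced inj) // => C phi pi pi'.
exact: exch.
Qed.

Lemma partition_family_exchangeable_of_kernel :
  tree_family_exchangeable (ancestral_branching_kernel p) ->
  partition_family_exchangeable p.
Proof.
move=> exchQ; suff exch (A : {fset nat}) : (2 <= #|` A|)%N -> exchangeable_at p A.
  by move=> A B psi pi pi' A2; apply: exch.
have [n] := ubnP #|` A|; elim: n A => // n IHn A ltAn A2 B psi pi pi' cardAB injAB.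
move=> pi_nt pi'_part.
(* The one-block partition is treated apart because it is never the root partition of a tree on
   [A]. *)
have [->|pi'_neq1] := eqVneq pi' (one_block A).
  by rewrite induced_one_block (injection_surj cardAB) // (p_one_block_exch A2 cardAB injAB).
have pi'_nt : pi' \in nontrivial_partitions A by rewrite in_fsetD1 pi'_neq1.
have A0 : A != fset0 by rewrite -cardfs_gt0 ltnW.
(* Only the root partition of [T] is prescribed; the other vertices are split into singletons. *)
have [|T TA rootT] := @frag_tree_of_block_partitions (fun c s => c = A -> s = pi) A A0.
  move=> c cA c2; have [->|neqcA] := eqVneq c A; first by exists pi.
  exists [fset [fset a] | a in c]; first exact: singletons_nontrivial.
  by move=> eqcA; rewrite eqcA eqxx in neqcA.
(* [T'] is chosen after [T]: at each vertex [c] other than [A], its partition must be charged by the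
   law that [T] selects there. *)
have [|T' T'A rootT'] := @frag_tree_of_block_partitions
    (fun c s => (c = A -> s = pi') /\ (c != A -> p c (block_partition T c) s != 0)) A A0.
  move=> c cA c2; have [->|neqcA] := eqVneq c A; first by exists pi'.
  have [s s_nt ps] := exists_nontrivial_neq0 c2 (block_partition_nontrivial TA cA c2).
  by exists s => //; split=> // eqcA; rewrite eqcA eqxx in neqcA.
have [_ inj] := injAB.
have /frag_treesP[_ AT subT _ _] := TA; have /frag_treesP[_ AT' subT' _ _] := T'A.
have rT : block_partition T A = pi by apply: rootT.
have rT' : block_partition T' A = pi' by apply: (rootT' A AT' A2).1.
have := exchQ A B psi T T' cardAB injAB TA T'A.
rewrite (kernel_induced _ _ _ inj) // [LHS]big_mkcond [RHS]big_mkcond.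
rewrite [LHS](big_fsetD1 A) //= [RHS](big_fsetD1 A) //= A2.
(* Vertices of [T'] other than [A] are strictly smaller than [A], so the induction hypothesis
   identifies their factors on both sides. *)
rewrite [X in _ = _ * X](_ : _ = \prod_(b <- T' `\ A)
    if (2 <= #|` b|)%N then branching_factor p T T' b else 1); last first.
  rewrite big_seq [in RHS]big_seq; apply: eq_bigr => b.
  rewrite in_fsetD1 => /andP[bA bT']; case: ifP => // b2.
  apply: (branching_factor_induced inj) => //; first exact: subT'.
  apply: IHn => //; apply: leq_trans (_ : #|` b| < #|` A|)%N _ => //.
  by apply: fproper_ltn_card; rewrite fproperEneq bA subT'.
rewrite -/(branching_factor p T T' A).
(* Both sides now share the product over the non-root vertices, which may be cancelled once shown to
   be nonzero. *)
move/mulIf => cancel_rest.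
have : branching_factor p T T' A =
    branching_factor p (induced psi T) (induced psi T') (psi @` A).
  apply: cancel_rest; rewrite prodf_seq_neq0.
  apply/allP => b; rewrite in_fsetD1 => /andP[bA bT'] /=.
  case: ifP => [b2|_]; last exact: oner_neq0.
  rewrite mulf_neq0 //; first by have [_ ->] := rootT' b bT' b2.
  rewrite invr_neq0 // one_sub_one_block_neq0 //.
  by apply: block_partition_nontrivial TA _ _ => //; apply: subT'.
rewrite /branching_factor !(induced_block_partition inj) // rT rT' (injection_surj cardAB) //.
(* The two root denominators coincide and are nonzero, so equality of the root factors gives
   equality of the numerators. *)
rewrite -(p_one_block_exch A2 cardAB injAB pi_nt).
have den0 := one_sub_one_block_neq0 A2 pi_nt.
exact: (mulIf (invr_neq0 den0)).
Qed.

End Exchangeability.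

Theorem theorem3p1 (R : realType) (p : partition_family R)
  (p_distr : forall (S : {fset nat}) (pi : {fset {fset nat}}),
     (2 <= #|` S|)%N -> pi \in nontrivial_partitions S ->
     is_distribution S (p S pi))
  (p_one_block_lt1 : forall (S : {fset nat}) (pi : {fset {fset nat}}),
     (2 <= #|` S|)%N -> pi \in nontrivial_partitions S ->
     p S pi (one_block S) < 1)
  (p_one_block_exch : forall (A B : {fset nat}) (psi : nat -> nat)
       (pi : {fset {fset nat}}),
     (2 <= #|` A|)%N -> #|` A| = #|` B| -> injection A B psi ->
     pi \in nontrivial_partitions A ->
     p A pi (one_block A) = p B (induced psi pi) (one_block B)) :
  tree_family_exchangeable (ancestral_branching_kernel p) <->
  partition_family_exchangeable p.
Proof.
split; first exact: partition_family_exchangeable_of_kernel.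
exact: kernel_exchangeable.
Qed.
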